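(* Let $k\ge 1$, let $U\subset\mathbb{R}^m$ be a domain, and let $f:U\times\mathbb{R}^m\to\mathcal{C}l_m$, $(x,u)\mapsto f(x,u)$, be continuously differentiable and such that for each fixed $x\in U$ the function $u\mapsto f(x,u)$ is a left monogenic polynomial homogeneous of degree $k$. Write $R_{k,u}$ for the Rarita-Schwinger operator in the variables $(x,u)$ and $R_{k,w}$ for the Rarita-Schwinger operator in the variables $(y,w)$. If $R_{k,u}f(x,u)=0$ for all $x\in U$, $u\in\mathbb{R}^m$, then $$R_{k,w}\Big[G(y)\,f\Big(y^{-1},\frac{ywy}{\|y\|^2}\Big)\Big]=0$$ for all $w\in\mathbb{R}^m$ and all $y\in\mathbb{R}^m\setminus\{0\}$ with $y^{-1}\in U$, where $G(y)=\dfrac{y}{\|y\|^m}$ (that is, under the substitution $x=y^{-1}$, $u=\dfrac{ywy}{\|y\|^2}$).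
   Context: Assume $m\ge 3$. $\mathcal{C}l_m$ is the real Clifford algebra generated by $\mathbb{R}^m$ with orthonormal basis $e_1,\dots,e_m$ and relations $e_ie_j+e_je_i=-2\delta_{ij}$; $\mathbb{R}^m$ is regarded as a subset of $\mathcal{C}l_m$, and products such as $ywy$ are Clifford products (so $ywy\in\mathbb{R}^m$ for $y,w\in\mathbb{R}^m$). For a nonzero vector $y$, $y^{-1}=-y/\|y\|^2$ is its inverse in $\mathcal{C}l_m$. The Dirac operator in a variable $x\in\mathbb{R}^m$ is $D_x=\sum_{i=1}^m e_i\partial_{x_i}$, acting by Clifford multiplication from the left. A $\mathcal{C}l_m$-valued function $p(u)$ is left monogenic if $D_up=0$. Let $\mathcal{H}_k$ be the space of $\mathcal{C}l_m$-valued harmonic polynomials in $u\in\mathbb{R}^m$ homogeneous of degree $k$, and $\mathcal{M}_k$ the space of $\mathcal{C}l_m$-valued left monogenic polynomials in $u$ homogeneous of degree $k$. One has the Almansi-Fischer decomposition $\mathcal{H}_k=\mathcal{M}_k\oplus u\mathcal{M}_{k-1}$, and $P_k:\mathcal{H}_k\to\mathcal{M}_k$ is the corresponding projection, given by $P_k=\frac{uD_u}{m+2k-2}+1$. For $f(x,u)$ with $f(x,\cdot)\in\mathcal{M}_k$ for each $x$, the Rarita-Schwinger operator in the variables $(x,u)$ is $$R_kf(x,u)=P_kD_xf(x,u)=\Big(\frac{uD_u}{m+2k-2}+1\Big)D_xf(x,u).$$ In the variables $(y,w)$ it is defined by the same formula with $x,u$ replaced by $y,w$. *)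

(* Defs.v *)
From HB Require Import structures.
From mathcomp Require Import all_boot all_order all_algebra.
From mathcomp Require Import all_classical all_reals all_analysis.

Set Implicit Arguments.
Unset Strict Implicit.
Unset Printing Implicit Defensive.

Import Order.TTheory GRing.Theory Num.Theory.
Import numFieldNormedType.Exports.

Local Open Scope classical_set_scope.
Local Open Scope ring_scope.

Section Blades.
Variables (R : realType) (m : nat).

(* An element is the row of its 2^m coordinates on the blades e_A, where, for
   A = {a1 < ... < ar}, e_A is the ordered product e_a1 ... e_ar.
   The normed structure is the sup norm of the coordinates. *)
Definition clifford : Type := 'rV[R]_#|{set 'I_m}|.

HB.instance Definition _ :=
  NormedModule.copy clifford 'rV[R]_#|{set 'I_m}|.

Definition blade (A : {set 'I_m}) : clifford := delta_mx 0 (enum_rank A).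

Definition ccoef (x : clifford) (A : {set 'I_m}) : R :=
  (x : 'rV_ _) 0 (enum_rank A).

Definition symdiff (A B : {set 'I_m}) : {set 'I_m} :=
  ((A :\: B) :|: (B :\: A))%SET.

(* e_A e_B = csign A B *: e_(A symdiff B): each b in B has to cross the a in A
   with b < a, and the pairs a = b contribute e_a e_a = -1. *)
Definition csign (A B : {set 'I_m}) : R :=
  \prod_(a in A) \prod_(b in B | (b <= a)%N) -1.

End Blades.

HB.lock Definition cmul (R : realType) (m : nat) (x y : clifford R m) :
    clifford R m :=
  \sum_A \sum_B (ccoef x A * ccoef y B * csign R A B) *: blade R (symdiff A B).

Section Clifford.
Variables (R : realType) (m : nat).

Local Notation clifford := (clifford R m).
Local Notation cmul := (@cmul R m).
Local Notation blade := (@blade R m).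
Local Notation csign := (@csign R m).
Local Notation symdiff := (@symdiff m).
Implicit Types (x y z : clifford) (A B C : {set 'I_m}).

Lemma ccoefD x y A : ccoef (x + y) A = ccoef x A + ccoef y A.
Proof. by rewrite /ccoef !mxE. Qed.

Lemma ccoefZ a x A : ccoef (a *: x) A = a * ccoef x A.
Proof. by rewrite /ccoef !mxE. Qed.

Lemma ccoef_blade A B : ccoef (blade A) B = (A == B)%:R.
Proof.
by rewrite /ccoef mxE eqxx /= eq_sym (inj_eq enum_rank_inj).
Qed.

Lemma clifford_decomp x : x = \sum_A ccoef x A *: blade A.
Proof.
rewrite {1}[x](row_sum_delta x) (reindex (@enum_rank {set 'I_m})) //=.
exact/onW_bij/enum_rank_bij.
Qed.

Lemma cmulDl : left_distributive cmul +%R.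
Proof.
move=> x y z; rewrite cmul.unlock -big_split; apply: eq_bigr => A _ /=.
rewrite -big_split; apply: eq_bigr => B _ /=.
by rewrite ccoefD !mulrDl scalerDl.
Qed.

Lemma cmulDr : right_distributive cmul +%R.
Proof.
move=> x y z; rewrite cmul.unlock -big_split; apply: eq_bigr => A _ /=.
rewrite -big_split; apply: eq_bigr => B _ /=.
by rewrite ccoefD mulrDr !mulrDl scalerDl.
Qed.

Lemma cmulZl a x y : cmul (a *: x) y = a *: cmul x y.
Proof.
rewrite cmul.unlock scaler_sumr; apply: eq_bigr => A _ /=.
rewrite scaler_sumr; apply: eq_bigr => B _ /=.
by rewrite ccoefZ scalerA !mulrA.
Qed.

Lemma cmulZr a x y : cmul x (a *: y) = a *: cmul x y.
Proof.
rewrite cmul.unlock scaler_sumr; apply: eq_bigr => A _ /=.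
rewrite scaler_sumr; apply: eq_bigr => B _ /=.
by rewrite ccoefZ scalerA mulrCA !mulrA.
Qed.

Lemma cmul_suml (I : Type) (r : seq I) P (F : I -> clifford) y :
  cmul (\sum_(i <- r | P i) F i) y = \sum_(i <- r | P i) cmul (F i) y.
Proof.
apply: (big_morph (cmul^~ y)) => [u v|]; first exact: cmulDl.
by have := cmulZl 0 0 y; rewrite !scale0r.
Qed.

Lemma cmul_sumr (I : Type) (r : seq I) P (F : I -> clifford) y :
  cmul y (\sum_(i <- r | P i) F i) = \sum_(i <- r | P i) cmul y (F i).
Proof.
apply: (big_morph (cmul y)) => [u v|]; first exact: cmulDr.
by have := cmulZr 0 y 0; rewrite !scale0r.
Qed.

Lemma cmul_blade A B :
  cmul (blade A) (blade B) = csign A B *: blade (symdiff A B).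
Proof.
rewrite cmul.unlock (bigD1 A) //= (bigD1 B) //= !ccoef_blade !eqxx !mul1r.
rewrite big1 ?addr0 => [|C /negPf CB]; last first.
  by rewrite !ccoef_blade eq_sym CB mulr0 mul0r scale0r.
rewrite big1 ?addr0 // => C /negPf CA; rewrite big1 // => D _.
by rewrite !ccoef_blade eq_sym CA !mul0r scale0r.
Qed.

Lemma in_symdiff A B i : (i \in symdiff A B) = (i \in A) (+) (i \in B).
Proof. by rewrite !inE; case: (i \in A); case: (i \in B). Qed.

Lemma symdiffA : associative symdiff.
Proof. by move=> A B C; apply/setP => i; rewrite !in_symdiff addbA. Qed.

Lemma sym0diff : left_id finset.set0 symdiff.
Proof. by move=> A; apply/setP => i; rewrite in_symdiff inE. Qed.

Lemma symdiff0 : right_id finset.set0 symdiff.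
Proof. by move=> A; apply/setP => i; rewrite in_symdiff inE addbF. Qed.

Lemma prod_symdiff (g : 'I_m -> R) A B : (forall i, g i * g i = 1) ->
  \prod_(i in symdiff A B) g i = \prod_(i in A) g i * \prod_(i in B) g i.
Proof.
move=> g2; rewrite ![\prod_(i in _) _]big_mkcond -big_split.
apply: eq_bigr => i _ /=; rewrite in_symdiff.
by case: (i \in A); case: (i \in B); rewrite /= ?mulr1 ?mul1r ?g2.
Qed.

Lemma csignDl A B C : csign (symdiff A B) C = csign A C * csign B C.
Proof.
apply: prod_symdiff => i; rewrite -big_split big1 //= => j _.
by rewrite mulrNN mulr1.
Qed.

Lemma csignDr A B C : csign A (symdiff B C) = csign A B * csign A C.
Proof.
rewrite /csign -big_split; apply: eq_bigr => i _ /=.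
have E (D : {set 'I_m}) : \prod_(b in D | (b <= i)%N) -1
    = \prod_(b in D) (if (b <= i)%N then -1 else 1) :> R by rewrite -big_mkcondr.
rewrite !E; apply: prod_symdiff => j.
by case: ifP; rewrite ?mulrNN mulr1.
Qed.

Lemma cmulA : associative cmul.
Proof.
move=> x y z; rewrite (clifford_decomp x) 3!cmul_suml; apply: eq_bigr => A _.
rewrite (clifford_decomp y) cmul_suml 2!cmul_sumr cmul_suml.
apply: eq_bigr => B _; rewrite (clifford_decomp z) 3!cmul_sumr.
apply: eq_bigr => C _.
rewrite !(cmulZl, cmulZr, cmul_blade) symdiffA csignDl csignDr !scalerA.
congr (_ *: _); rewrite -!mulrA [RHS]mulrCA; congr (_ * _).
rewrite [RHS]mulrCA; congr (_ * (_ * _)).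
by rewrite mulrC mulrA.
Qed.

Lemma cmul1l : left_id (blade finset.set0) cmul.
Proof.
move=> x; rewrite [in LHS](clifford_decomp x) cmul_sumr [RHS]clifford_decomp.
apply: eq_bigr => A _; rewrite cmulZr cmul_blade sym0diff.
by rewrite /csign big_set0 scale1r.
Qed.

Lemma cmul1r : right_id (blade finset.set0) cmul.
Proof.
move=> x; rewrite [in LHS](clifford_decomp x) cmul_suml [RHS]clifford_decomp.
apply: eq_bigr => A _; rewrite cmulZl cmul_blade symdiff0.
rewrite /csign big1 ?scale1r // => i _; rewrite big1 // => j.
by rewrite inE.
Qed.

Lemma clifford1_neq0 : blade finset.set0 != 0.
Proof.
apply/eqP => /(congr1 (fun x => ccoef x finset.set0)).
by rewrite ccoef_blade eqxx /ccoef mxE => /eqP; rewrite oner_eq0.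
Qed.

HB.instance Definition _ := GRing.Zmodule_isNzRing.Build clifford
  cmulA cmul1l cmul1r cmulDl cmulDr clifford1_neq0.

HB.instance Definition _ := GRing.Lmodule_isLalgebra.Build R clifford
  (fun a x y => esym (cmulZl a x y)).

HB.instance Definition _ := GRing.Lalgebra_isAlgebra.Build R clifford
  (fun a x y => esym (cmulZr a x y)).

Definition cgen (i : 'I_m) : clifford := blade [set i]%SET.

Definition cvec (v : 'rV[R]_m) : clifford := \sum_i v 0 i *: cgen i.

(* Left inverse of cvec; nothing is lost on elements of R^m (cvec_sandwich). *)
Definition vpart (x : clifford) : 'rV[R]_m := \row_i ccoef x [set i]%SET.

(* The norm `|v| of the library is the sup norm. *)
Definition enorm (v : 'rV[R]_m) : R := Num.sqrt (\sum_i v 0 i ^+ 2).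

Lemma cgenM i j : cgen i * cgen j + cgen j * cgen i = - 2 * (i == j)%:R.
Proof.
have E k l : cgen k * cgen l
    = (if (l <= k)%N then -1 else 1) *: blade (symdiff [set k]%SET [set l]%SET).
  rewrite [LHS]cmul_blade; congr (_ *: _).
  by rewrite /csign big_set1 big_mkcondr big_set1.
have S A : symdiff A A = finset.set0.
  by apply/setP => k; rewrite in_symdiff addbb inE.
have C A B : symdiff A B = symdiff B A.
  by apply/setP => k; rewrite !in_symdiff addbC.
rewrite !E; case: eqVneq => [->|ij].
  by rewrite leqnn S scaleN1r mulr1 -opprD -mulr2n.
rewrite [symdiff [set j]%SET _]C mulr0 -scalerDl.
case: ltngtP => [_|_|/val_inj ji]; rewrite ?addNr ?subrr ?scale0r //.
by rewrite ji eqxx in ij.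
Qed.

Lemma blade_prod A : blade A = \prod_(i <- enum A) cgen i.
Proof.
have : sorted ltn (map val (enum A)).
  apply: (subseq_sorted ltn_trans (s2 := map val (enum 'I_m))).
    apply: map_subseq; rewrite /(enum A) enumT /=; exact: filter_subseq.
  by rewrite val_enum_ord iota_ltn_sorted.
have -> : blade A = blade [set i in enum A]%SET.
  by congr blade; apply/setP => i; rewrite inE mem_enum.
elim: (enum A) => [|i s IH] /= srt.
  by rewrite big_nil; congr blade; apply/setP => i; rewrite !inE.
rewrite big_cons -IH ?(path_sorted srt) //.
rewrite [RHS]cmul_blade.
have lt_i j : j \in s -> (i < j)%N.
  move: srt; rewrite path_sortedE; last exact: ltn_trans.
  by move=> /andP[/allP si _] js; apply: si; rewrite map_f.
have -> : csign [set i]%SET [set j in s]%SET = 1.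
  rewrite /csign big_set1 big1 // => j; rewrite inE => /andP[/lt_i].
  by rewrite ltnNge => /negPf->.
rewrite scale1r; congr blade; apply/setP => j; rewrite in_symdiff !inE.
by case: eqVneq => //= ->; case: (boolP (i \in s)) => // /lt_i; rewrite ltnn.
Qed.

Lemma cvecM v w :
  cvec v * cvec w + cvec w * cvec v = - (2 * \sum_i v 0 i * w 0 i)%:A.
Proof.
have E (a b : 'rV[R]_m) : cvec a * cvec b
    = \sum_i \sum_j (a 0 i * b 0 j) *: (cgen i * cgen j).
  rewrite mulr_suml; apply: eq_bigr => i _; rewrite mulr_sumr.
  by apply: eq_bigr => j _; rewrite -scalerAl -scalerAr scalerA.
rewrite E (E w) [X in _ + X]exchange_big -big_split /=.
rewrite mulr_sumr scaler_suml -sumrN; apply: eq_bigr => i _.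
rewrite -big_split (bigD1 i) //= big1 => [|j ji]; last first.
  by rewrite [w 0 j * _]mulrC -scalerDr cgenM eq_sym (negPf ji) mulr0 scaler0.
rewrite [w 0 i * _]mulrC -scalerDr cgenM eqxx mulr1 addr0 mulrC -scalerA.
by rewrite scalerN scalerA [2 * _]mulrC -[in RHS]scalerA scaler_nat.
Qed.

Lemma enorm2 v : enorm v ^+ 2 = \sum_i v 0 i ^+ 2.
Proof. by rewrite sqr_sqrtr // sumr_ge0 // => i _; rewrite sqr_ge0. Qed.

Lemma enorm_neq0 v : v != 0 -> enorm v != 0.
Proof.
apply: contra_neq => v0; apply/rowP => i; rewrite mxE; apply/eqP.
have /eqP := enorm2 v; rewrite v0 expr0n /= eq_sym.
rewrite psumr_eq0 => [/allP/(_ i (mem_index_enum _))|j _]; last exact: sqr_ge0.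
by rewrite sqrf_eq0.
Qed.

Lemma cvec_sqr v : cvec v * cvec v = - (enorm v ^+ 2)%:A.
Proof.
have two0 : (2 : R) != 0 by rewrite pnatr_eq0.
apply: (scalerI two0); rewrite scaler_nat mulr2n cvecM enorm2 scalerN scalerA.
by congr (- (_ * _)%:A); apply: eq_bigr.
Qed.

Lemma cvecZ a v : cvec (a *: v) = a *: cvec v.
Proof.
by rewrite /cvec scaler_sumr; apply: eq_bigr => i _; rewrite mxE scalerA.
Qed.

Lemma cvecD v w : cvec (v + w) = cvec v + cvec w.
Proof.
by rewrite /cvec -big_split; apply: eq_bigr => i _; rewrite mxE scalerDl.
Qed.

Lemma cvecK : cancel cvec vpart.
Proof.
move=> v; apply/rowP => i; rewrite mxE /ccoef /cvec summxE (bigD1 i) //= big1.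
  by rewrite !mxE !eqxx mulr1 addr0.
move=> j ji; rewrite !mxE eqxx (inj_eq enum_rank_inj) (inj_eq set1_inj).
by rewrite eq_sym (negPf ji) mulr0.
Qed.

Definition vinv (y : 'rV[R]_m) : 'rV[R]_m := - (enorm y ^- 2 *: y).

Lemma cvec_vinv (y : 'rV[R]_m) : y != 0 ->
  cvec (vinv y) * cvec y = 1 /\ cvec y * cvec (vinv y) = 1.
Proof.
move=> y0; rewrite /vinv -scaleNr cvecZ -scalerAl -scalerAr cvec_sqr scaleNr.
by rewrite scalerN opprK scalerA mulVf ?scale1r // expf_neq0 ?enorm_neq0.
Qed.

Definition sandwich (y w : 'rV[R]_m) : 'rV[R]_m :=
  vpart (cvec y * cvec w * cvec y).

Lemma cvec_sandwich (y w : 'rV[R]_m) :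
  cvec (sandwich y w) = cvec y * cvec w * cvec y.
Proof.
rewrite /sandwich.
have -> : cvec y * cvec w * cvec y
    = cvec ((- (2 * \sum_i y 0 i * w 0 i)) *: y + enorm y ^+ 2 *: w).
  have /(canRL (addrK _)) -> := cvecM y w.
  rewrite cvecD !cvecZ mulrDl mulNr -scalerAl mul1r scaleNr mulNr; congr (_ + _).
  by rewrite -mulrA cvec_sqr mulrN opprK -scalerAr mulr1.
by rewrite cvecK.
Qed.

(* The limit defining 'D_v p u is a total operator: it is the derivative
   wherever p is differentiable. *)
Definition dirac_op (p : 'rV[R]_m -> clifford) (u : 'rV[R]_m) : clifford :=
  \sum_i cgen i * 'D_(delta_mx 0 i) p u.

Definition homogeneous_poly (k : nat) (p : 'rV[R]_m -> clifford) : Prop :=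
  exists c : {ffun 'I_m -> 'I_k.+1} -> clifford, forall u,
    p u = \sum_(a : {ffun 'I_m -> 'I_k.+1} | (\sum_i a i)%N == k)
            (\prod_i u 0 i ^+ a i) *: c a.

Definition left_monogenic (p : 'rV[R]_m -> clifford) : Prop :=
  forall u, dirac_op p u = 0.

Definition monogenic_space (k : nat) : set ('rV[R]_m -> clifford) :=
  [set p | homogeneous_poly k p /\ left_monogenic p].

Definition fischer_proj (k : nat) (p : 'rV[R]_m -> clifford)
    (u : 'rV[R]_m) : clifford :=
  (m%:R + 2 * k%:R - 2)^-1 *: (cvec u * dirac_op p u) + p u.

Definition rarita_schwinger (k : nat)
    (f : 'rV[R]_m -> 'rV[R]_m -> clifford) (x u : 'rV[R]_m) : clifford :=
  fischer_proj k (fun u' => dirac_op (f^~ u') x) u.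

Definition Gkernel (y : 'rV[R]_m) : clifford := enorm y ^- m *: cvec y.

End Clifford.

(* Used on open sets A only, where a continuous differential amounts to
   continuity of every directional derivative in finite dimension. *)
Definition C1_on (R : realType) (V W : normedModType R) (A : set V)
    (F : V -> W) : Prop :=
  forall p, A p -> differentiable F p /\ forall v, {for p, continuous ('D_v F)}.

(* Main.v *)
Require Import Defs.
From HB Require Import structures.
From mathcomp Require Import all_boot all_order all_algebra.
From mathcomp Require Import all_classical all_reals all_analysis.
From mathcomp Require Import ring.

Set Implicit Arguments.
Unset Strict Implicit.
Unset Printing Implicit Defensive.

Import Order.TTheory GRing.Theory Num.Theory.
Import numFieldNormedType.Exports.

Local Open Scope classical_set_scope.
Local Open Scope ring_scope.

(** The argument is a direct computation of the y-derivative, organised around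
    the reflection s_y(w) = ywy/|y|^2 = w - 2<y,w>y/|y|^2 in the hyperplane
    orthogonal to y.  Put x = y^-1, u = s_y(w), n = |y|^2.

    The differential of y |-> y^-1 is v |-> -s_y(v)/n, and that of
    y |-> s_y(w) is v |-> -(2/n)(<v,w> y + <y,w> s_y(v)).  Since s_y is an
    orthogonal map that anticommutes with y in the sense v y = - y s_y(v), the
    sum of the e_i y L(s_y e_i) over the basis is - y (sum of the e_i L(e_i))
    for every linear L (dirac_symbol_vrefl).  The kernel G is monogenic, so the
    product and chain rules give (dirac_inversion)
      D_y [G(y) f(y^-1, s_y(w))] = |y|^(-m-2) y K(s_y(w)),
      K(u) = D_x f(x,u) + u 'D_(2y) (f x)(u);
    the term with the coefficient <y,w> has disappeared because f(x,.) is left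
    monogenic.  The map K |-> y K(s_y(.)) commutes with the Fischer projection
    P_k (fischer_proj_vrefl), so it remains to see that P_k K = 0.  The first
    summand of K is killed by P_k, which is the hypothesis R_k f = 0.  In the
    second, 'D_(2y) (f x) is left monogenic and homogeneous of degree k-1, and
    P_k kills u M_(k-1) (fischer_proj_cvecl): by Euler's identity
    D_u (u g) = -(m+2k-2) g for g in M_(k-1).

    What is left is regularity.  As f is only continuously differentiable,
    differentiability of D_x f(x,u) in u, as well as monogenicity of a
    directional derivative of a monogenic polynomial, are obtained by
    interpolation: a polynomial of degree at most k in each variable is a
    combination of its values at finitely many nodes, with fixed polynomial
    coefficients, and such identities survive differentiation with respect to
    any parameter on which the polynomial depends (interpolable_derive,
    monogenic_derive). *)

(** * Differentiation rules *)

Section ProductRules.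
Variables (R : realType) (V : normedModType R).

Section Scale.
Variable W : normedModType R.

(** A name for the operation, which can carry a bilinear structure. *)
Definition scale_op (a : R) (x : W) : W := a *: x.

Fact scale_op_is_bilinear :
  bilinear_for (GRing.Scale.Law.clone _ _ *:%R _)
    (GRing.Scale.Law.clone _ _ *:%R _) scale_op.
Proof.
split=> [x|a] b u v; rewrite /scale_op /=; first by rewrite scalerDl scalerA.
by rewrite scalerDr !scalerA mulrC.
Qed.

HB.instance Definition _ :=
  bilinear_isBilinear.Build R R W W _ _ scale_op scale_op_is_bilinear.

Lemma is_diff_scale (f df : V -> R) (g dg : V -> W) x :
  is_diff x f df -> is_diff x g dg ->
  is_diff x (fun y => f y *: g y) (fun v => df v *: g x + f x *: dg v).
Proof.
move=> dfx dgx.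
have cs : continuous (fun p : R * W => scale_op p.1 p.2).
  exact: scale_continuous.
have dp : is_diff (f x, g x) (fun p : R * W => scale_op p.1 p.2)
    (fun p => scale_op (f x) p.2 + scale_op p.1 (g x)).
  by apply: DiffDef; [exact: differentiable_bilin|rewrite diff_bilin].
have := @is_diff_comp _ _ _ _ (fun y => (f y, g y)) _ _ _ x _ dp.
move=> /(_ _ (is_diff_pair dfx dgx)) h.
apply: is_diff_eq h _; apply/funext => v /=; rewrite addrC //.
Qed.

End Scale.

Lemma is_diff_bigsum (W : normedModType R) (I : finType)
    (f df : I -> V -> W) x : (forall i, is_diff x (f i) (df i)) ->
  is_diff x (fun y => \sum_i f i y) (fun v => \sum_i df i v).
Proof.
move=> h.
have E (g : I -> V -> W) : (fun y => \sum_i g i y) = \sum_i g i.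
  by apply/funext => y; rewrite fct_sumE.
rewrite !E; elim/big_ind2 : _ => // *; [exact: is_diff_cst|exact: is_diffD].
Qed.

Lemma is_diff_comp_real (g : R -> R) (f df : V -> R) x dg :
  is_diff x f df -> is_derive (f x) 1 g dg ->
  is_diff x (fun y => g (f y)) (fun v => dg * df v).
Proof.
move=> dfx [dgx dgE].
have gd : differentiable g (f x) by exact/derivable1_diffP.
have gi : is_diff (f x) g (fun h => h * dg).
  by apply: DiffDef => //; rewrite diff1E // derive1E dgE.
have h := is_diff_comp dfx gi.
apply: is_diff_eq h _.
by apply/funext => v /=; rewrite mulrC.
Qed.

Lemma derive_is_diff (W : normedModType R) (p dp : V -> W) (u v : V) :
  is_diff u p dp -> 'D_v p u = dp v.
Proof. by case=> dpu dpE; rewrite deriveE // dpE. Qed.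

End ProductRules.

Section CliffordProduct.
Variables (R : realType) (m : nat).
Local Notation Cl := (clifford R m).

(** As for [scale_op], the name carries the bilinear structure. *)
Definition clif_mul (a b : Cl) : Cl := a * b.

Fact clif_mul_is_bilinear :
  bilinear_for (GRing.Scale.Law.clone _ _ *:%R _)
    (GRing.Scale.Law.clone _ _ *:%R _) clif_mul.
Proof.
split=> [x|a] b u v; rewrite /clif_mul /=; first by rewrite mulrDl scalerAl.
by rewrite mulrDr scalerAr.
Qed.

HB.instance Definition _ :=
  bilinear_isBilinear.Build R Cl Cl Cl _ _ clif_mul clif_mul_is_bilinear.

Lemma ccoef_continuous (A : {set 'I_m}) : continuous (fun x : Cl => ccoef x A).
Proof. exact: coord_continuous. Qed.

(** In coordinates the product is a finite sum of products of two coordinates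
    times constant vectors. *)
Lemma clif_mul_continuous : continuous (fun p : Cl * Cl => clif_mul p.1 p.2).
Proof.
have E : (fun p : Cl * Cl => clif_mul p.1 p.2) = (fun p => \sum_A \sum_B
    (ccoef p.1 A * ccoef p.2 B) *: (blade R A * blade R B : Cl)).
  apply/funext => -[a b] /=; rewrite /clif_mul {1}(clifford_decomp a) mulr_suml.
  apply: eq_bigr => A _; rewrite {1}(clifford_decomp b) mulr_sumr.
  by apply: eq_bigr => B _; rewrite -scalerAl -scalerAr scalerA.
rewrite E; apply: (continuous_big (@add_continuous Cl)) => A _.
apply: (continuous_big (@add_continuous Cl)) => B _ p.
apply: cvgZr_tmp.
apply: cvgM.
  exact: (continuous_comp (@cvg_fst _ _ _ _ _) (@ccoef_continuous A p.1)).
exact: (continuous_comp (@cvg_snd _ _ _ _ _) (@ccoef_continuous B p.2)).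
Qed.

Lemma is_diff_mul (V : normedModType R) (f df g dg : V -> Cl) x :
  is_diff x f df -> is_diff x g dg ->
  is_diff x (fun y => f y * g y) (fun v => df v * g x + f x * dg v).
Proof.
move=> dfx dgx; have cs := clif_mul_continuous.
have dp : is_diff (f x, g x) (fun p : Cl * Cl => clif_mul p.1 p.2)
    (fun p => clif_mul (f x) p.2 + clif_mul p.1 (g x)).
  by apply: DiffDef; [exact: differentiable_bilin|rewrite diff_bilin].
have := @is_diff_comp _ _ _ _ (fun y => (f y, g y)) _ _ _ x _ dp.
move=> /(_ _ (is_diff_pair dfx dgx)) h.
by apply: is_diff_eq h _; apply/funext => v /=; rewrite addrC.
Qed.

End CliffordProduct.

(** * Differentials of the norm, the inversion, the reflection and the kernel *)

Section Differentials.
Variables (R : realType) (m : nat).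
Local Notation vec := 'rV[R]_m.

Definition dot (v w : vec) : R := \sum_i v 0 i * w 0 i.

Lemma dotC v w : dot v w = dot w v.
Proof. by apply: eq_bigr => i _; rewrite mulrC. Qed.

Lemma enorm_dot v : enorm v ^+ 2 = dot v v.
Proof. by rewrite enorm2. Qed.

Lemma is_diff_coord (y : vec) i :
  is_diff y (fun v : vec => v 0 i) (fun v : vec => v 0 i).
Proof.
have @f : {linear vec -> R}.
  by exists (fun N : vec => N 0 i); do 2![eexists]; do ?[constructor];
     rewrite ?mxE// => ? *; rewrite ?mxE//; move=> ?; rewrite !mxE.
have fc : continuous f by exact: coord_continuous.
rewrite (_ : (fun _ => _) = f) //.
by apply: DiffDef; [exact: linear_differentiable|rewrite diff_lin].
Qed.

Lemma is_diff_cvec (y : vec) : is_diff y (@cvec R m) (@cvec R m).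
Proof.
apply: (@is_diff_bigsum _ _ _ _ (fun i (v : vec) => v 0 i *: cgen R i)
  (fun i (v : vec) => v 0 i *: cgen R i)) => i.
apply: is_diff_eq.
  exact: (is_diff_scale (is_diff_coord y i) (is_diff_cst (cgen R i) y)).
by apply/funext => v /=; rewrite scaler0 addr0.
Qed.

Lemma is_diff_dot (w y : vec) : is_diff y (dot^~ w) (dot^~ w).
Proof.
apply: (@is_diff_bigsum _ _ _ _ (fun i (v : vec) => v 0 i * w 0 i)
  (fun i (v : vec) => v 0 i * w 0 i)) => i.
apply: is_diff_eq.
  exact: (is_diff_scale (is_diff_coord y i) (is_diff_cst (w 0 i) y)).
by apply/funext => v /=; rewrite scaler0 addr0.
Qed.

Lemma is_diff_sqnorm (y : vec) :
  is_diff y (fun v => dot v v) (fun v => 2 * dot y v).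
Proof.
have -> : (fun v => 2 * dot y v) =
    (fun v : vec => \sum_i 2 * (y 0 i * v 0 i)).
  by apply/funext => v; rewrite /dot mulr_sumr.
apply: (@is_diff_bigsum _ _ _ _ (fun i (v : vec) => v 0 i * v 0 i)) => i.
apply: is_diff_eq.
  exact: (is_diff_scale (is_diff_coord y i) (is_diff_coord y i)).
by apply/funext => v /=; rewrite /GRing.scale /=; ring.
Qed.

Lemma enorm_gt0 (y : vec) : y != 0 -> 0 < enorm y.
Proof. by move=> y0; rewrite lt_neqAle eq_sym enorm_neq0 //= sqrtr_ge0. Qed.

Lemma is_derive_negpow (p : nat) (t : R) : t != 0 ->
  is_derive t 1 (fun s : R => s ^- p) (- p%:R * t ^- p.+1).
Proof.
move=> t0.
have h : is_derive t (1 : R) ((@id R) ^+ p) ((p%:R * t ^+ p.-1) *: 1).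
  exact: is_deriveX.
have E : (fun s : R => s ^+ p) = (@id R) ^+ p.
  by apply/funext => s; rewrite exprfctE.
have h' : is_derive t 1 (fun s : R => s ^+ p) ((p%:R * t ^+ p.-1) *: 1).
  by rewrite E.
have [dp dE] := h'.
apply: DeriveDef.
  by apply: (@derivableV _ _ (fun s : R => s ^+ p)); [rewrite expf_neq0|].
rewrite (@deriveV _ _ (fun s : R => s ^+ p)) ?expf_neq0 //.
rewrite dE /GRing.scale /= mulr1.
case: p {h h' E dp dE} => [|p /=]; first by rewrite !(mul0r, mulr0, oppr0).
rewrite !exprS; field.
by rewrite t0 expf_neq0.
Qed.

Lemma is_diff_enorm (y : vec) : y != 0 ->
  is_diff y (@enorm R m) (fun v => (enorm y)^-1 * dot y v).
Proof.
move=> y0.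
have n0 : 0 < dot y y by rewrite -enorm_dot exprn_gt0 // enorm_gt0.
have E : @enorm R m = fun v => Num.sqrt (dot v v) by [].
rewrite [X in is_diff_def _ X]E; apply: is_diff_eq.
  exact: (is_diff_comp_real (is_diff_sqnorm y) (is_derive1_sqrt n0)).
apply/funext => v; rewrite -[Num.sqrt _]/(enorm y); field.
by rewrite enorm_neq0.
Qed.

(** Used for the exponents 2, in the inversion and the reflection, and m, in
    the kernel. *)
Lemma is_diff_enorm_negpow (p : nat) (y : vec) : y != 0 ->
  is_diff y (fun v => enorm v ^- p)
    (fun v => - p%:R * enorm y ^- p.+2 * dot y v).
Proof.
move=> y0; apply: is_diff_eq.
  exact: (is_diff_comp_real (is_diff_enorm y0)
    (is_derive_negpow p (enorm_neq0 y0))).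
apply/funext => v; rewrite !exprS; field.
by rewrite expf_neq0 enorm_neq0.
Qed.

Definition vrefl (y v : vec) : vec := v - (2 * dot y v * enorm y ^- 2) *: y.

(** Moving w past the left y by the Clifford relation leaves y y = -|y|^2.
    The right-hand side is polynomial in y, hence easy to differentiate. *)
Lemma sandwichE (y w : vec) :
  sandwich y w = enorm y ^+ 2 *: w - (2 * dot y w) *: y.
Proof.
apply: (can_inj (@cvecK R m)); rewrite cvec_sandwich.
have /(canRL (addrK _)) -> := cvecM y w.
rewrite mulrBl -mulrA cvec_sqr mulrN opprK mulNr -scalerAl mul1r -scalerAr mulr1.
by rewrite -scaleNr addrC -cvecZ -[in LHS]cvecZ -cvecD scaleNr.
Qed.

Lemma sandwich_vrefl (y w : vec) : y != 0 ->
  enorm y ^- 2 *: sandwich y w = vrefl y w.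
Proof.
move=> y0; rewrite sandwichE scalerBr !scalerA mulVf ?expf_neq0 ?enorm_neq0 //.
by rewrite scale1r mulrC.
Qed.

(** The inversion y |-> -y/|y|^2 is conformal: up to the factor -1/|y|^2 its
    differential is the reflection. *)
Lemma is_diff_vinv (y : vec) : y != 0 ->
  is_diff y (@vinv R m) (fun v => - enorm y ^- 2 *: vrefl y v).
Proof.
move=> y0.
have h := is_diffN (is_diff_scale (is_diff_enorm_negpow 2 y0) (is_diff_id y)).
apply: (is_diff_eq h).
apply/funext => v; rewrite /vrefl !fctE; apply/rowP => i; rewrite !mxE /=.
field; exact: enorm_neq0.
Qed.

(** Differentiating the direction y of the reflection only sees v through
    <v,w> and through the reflected vector; the latter term will contribute a
    Dirac operator, and hence vanish on monogenic functions. *)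
Lemma is_diff_sandwich (y w : vec) : y != 0 ->
  is_diff y (fun z => enorm z ^- 2 *: sandwich z w)
    (fun v => - (2 * enorm y ^- 2) *: (dot v w *: y + dot y w *: vrefl y v)).
Proof.
move=> y0.
have -> : (fun z => enorm z ^- 2 *: sandwich z w) =
    (fun z => enorm z ^- 2 *: (dot z z *: w - (2 * dot z w) *: z)).
  by apply/funext => z; rewrite sandwichE enorm_dot.
have d1 := is_diff_scale (is_diff_sqnorm y) (is_diff_cst w y).
have d2 := is_diff_scale (is_diffZ 2 (is_diff_dot w y)) (is_diff_id y).
have h := is_diff_scale (is_diff_enorm_negpow 2 y0) (is_diffB d1 d2).
apply: (is_diff_eq h).
apply/funext => v; rewrite /vrefl !fctE; apply/rowP => i; rewrite !mxE /=.
rewrite -enorm_dot /GRing.scale /=.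
field; exact: enorm_neq0.
Qed.

Lemma is_diff_Gkernel (y : vec) : y != 0 ->
  is_diff y (@Gkernel R m)
    (fun v => (- m%:R * enorm y ^- m.+2 * dot y v) *: cvec y
              + enorm y ^- m *: cvec v).
Proof.
move=> y0.
exact: (is_diff_scale (is_diff_enorm_negpow m y0) (is_diff_cvec y)).
Qed.

End Differentials.

(** * The Dirac operator on linear maps *)

Section DiracSymbol.
Variables (R : realType) (m : nat).
Local Notation Cl := (clifford R m).
Local Notation vec := 'rV[R]_m.
Implicit Types (y v w : vec) (c : Cl).

(** The Dirac operator depends on the differential only; splitting off this
    linear functional turns the chain rule into algebra. *)
Definition dirac_symbol (L : vec -> Cl) : Cl :=
  \sum_i cgen R i * L (delta_mx 0 i).

Lemma dirac_op_is_diff (p dp : vec -> Cl) u :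
  is_diff u p dp -> dirac_op p u = dirac_symbol dp.
Proof.
by case=> dpu dpE; apply: eq_bigr => i _; rewrite deriveE // dpE.
Qed.

Lemma dirac_symbolD (L M : vec -> Cl) :
  dirac_symbol (fun v => L v + M v) = dirac_symbol L + dirac_symbol M.
Proof.
by rewrite /dirac_symbol -big_split; apply: eq_bigr => i _; rewrite mulrDr.
Qed.

Lemma dirac_symbolZ a (L : vec -> Cl) :
  dirac_symbol (fun v => a *: L v) = a *: dirac_symbol L.
Proof.
by rewrite /dirac_symbol scaler_sumr; apply: eq_bigr => i _; rewrite scalerAr.
Qed.

Lemma cvec_delta i : cvec (delta_mx 0 i : vec) = cgen R i.
Proof.
rewrite /cvec (bigD1 i) //= mxE !eqxx scale1r big1 ?addr0 // => j /negPf ji.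
by rewrite mxE ji scale0r.
Qed.

Lemma dot_delta i v : dot (delta_mx 0 i) v = v 0 i.
Proof.
rewrite /dot (bigD1 i) //= mxE !eqxx mul1r big1 ?addr0 // => j /negPf ji.
by rewrite mxE ji mul0r.
Qed.

Lemma dirac_symbol_dot w c : dirac_symbol (fun v => dot v w *: c) = cvec w * c.
Proof.
rewrite /cvec mulr_suml; apply: eq_bigr => i _.
by rewrite dot_delta -scalerAr scalerAl.
Qed.

Lemma cvec_anti v y :
  cvec v * cvec y = - (cvec y * cvec v) - (2 * dot v y)%:A.
Proof. by rewrite addrC; have /(canRL (addrK _)) := cvecM v y. Qed.

Lemma dirac_symbol_mulr (L : vec -> Cl) c :
  dirac_symbol (fun v => L v * c) = dirac_symbol L * c.
Proof. by rewrite mulr_suml; apply: eq_bigr => i _; rewrite mulrA. Qed.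

Lemma dirac_symbol_cvec : dirac_symbol (@cvec R m) = (- m%:R)%:A.
Proof.
have two0 : (2 : R) != 0 by rewrite pnatr_eq0.
rewrite /dirac_symbol (eq_bigr (fun=> (-1)%:A : Cl)) => [|i _].
  rewrite sumr_const card_ord scalerMnl; congr (_ *: _).
  by rewrite mulNrn.
rewrite cvec_delta; apply: (scalerI two0); rewrite scaler_nat mulr2n cgenM eqxx.
by rewrite mulr1 scaleN1r scalerN scaler_nat.
Qed.

Lemma sum_delta_linear (L : {linear vec -> Cl}) y :
  \sum_i dot (delta_mx 0 i) y *: L (delta_mx 0 i) = L y.
Proof.
rewrite {2}[y]row_sum_delta linear_sum; apply: eq_bigr => i _.
by rewrite dot_delta linearZ.
Qed.

(** Moving e_i past y changes the sign and leaves the terms -2 y_i L(e_i), which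
    add up to -2 L(y). *)
Lemma dirac_symbol_cvecl y (L : {linear vec -> Cl}) :
  dirac_symbol (fun v => cvec y * L v) = - (cvec y * dirac_symbol L) - 2 *: L y.
Proof.
rewrite -sum_delta_linear scaler_sumr mulr_sumr -!sumrN -big_split /=.
apply: eq_bigr => i _; rewrite mulrA -{1}cvec_delta cvec_anti mulrBl mulNr.
by rewrite -mulrA cvec_delta -scalerAl mul1r scalerA.
Qed.

(** The reflection replaces L(v) by L(v) - 2<y,v>L(y)/n; as y y = -n, the
    correction is exactly the term -2 L(y) of [dirac_symbol_cvecl]. *)
Lemma dirac_symbol_vrefl y (L : {linear vec -> Cl}) : y != 0 ->
  dirac_symbol (fun v => cvec y * L (vrefl y v)) = - (cvec y * dirac_symbol L).
Proof.
move=> y0.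
transitivity (dirac_symbol (fun v => cvec y * L v
    + - (2 * enorm y ^- 2) *: (dot v y *: (cvec y * L y)))).
  apply: eq_bigr => i _; congr (_ * _); rewrite /vrefl linearB linearZ /= mulrBr.
  rewrite scalerA -scalerAr -scaleNr; congr (_ + _ *: _).
  by rewrite dotC; ring.
rewrite dirac_symbolD dirac_symbolZ dirac_symbol_dot dirac_symbol_cvecl.
rewrite mulrA cvec_sqr mulNr -scalerAl mul1r.
rewrite scalerN scaleNr opprK scalerA divfK ?subrK //.
by rewrite expf_neq0 // enorm_neq0.
Qed.

Lemma cvec_mulr_vrefl y w : y != 0 ->
  cvec w * cvec y = - (cvec y * cvec (vrefl y w)).
Proof.
move=> y0; rewrite -sandwich_vrefl // cvecZ cvec_sandwich -scalerAr !mulrA.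
rewrite cvec_sqr !mulNr scalerN opprK -!scalerAl mul1r scalerA mulVf ?scale1r //.
by rewrite expf_neq0 // enorm_neq0.
Qed.

(** The function y/|y|^m is monogenic away from 0: the derivative of |y|^-m
    contributes -m|y|^(-m-2) y y = m|y|^-m, and that of y cancels it, since
    the sum of the e_i e_i is -m. *)
Lemma dirac_symbol_Gkernel y : y != 0 ->
  dirac_symbol (fun v => (- m%:R * enorm y ^- m.+2 * dot y v) *: cvec y
              + enorm y ^- m *: cvec v : Cl) = 0.
Proof.
move=> y0; rewrite dirac_symbolD dirac_symbolZ dirac_symbol_cvec.
have -> :
    dirac_symbol (fun v => (- m%:R * enorm y ^- m.+2 * dot y v) *: cvec y) =
    dirac_symbol (fun v => (- m%:R * enorm y ^- m.+2) *: (dot v y *: cvec y)).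
  by apply: eq_bigr => i _; rewrite scalerA dotC.
rewrite dirac_symbolZ dirac_symbol_dot cvec_sqr scalerN -scaleNr !scalerA.
rewrite -scalerDl.
rewrite [X in X *: _](_ : _ = 0) ?scale0r // !exprS; field.
by rewrite expf_neq0 enorm_neq0.
Qed.

End DiracSymbol.

(** * The Dirac and Fischer operators under the inversion *)

Section Inversion.
Variables (R : realType) (m : nat).
Local Notation Cl := (clifford R m).
Local Notation vec := 'rV[R]_m.
Implicit Types (y v w x u : vec).

Lemma is_diff_partial1 (f : vec -> vec -> Cl) x u :
  differentiable (fun p : vec * vec => f p.1 p.2) (x, u) ->
  is_diff x (f^~ u) (fun v => 'd (fun p : vec * vec => f p.1 p.2) (x, u) (v, 0)).
Proof.
move=> df; have h := is_diff_comp (is_diff_pair (is_diff_id x) (is_diff_cst u x))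
  (differentiableP df).
exact: (is_diff_eq h).
Qed.

Lemma is_diff_partial2 (f : vec -> vec -> Cl) x u :
  differentiable (fun p : vec * vec => f p.1 p.2) (x, u) ->
  is_diff u (f x) (fun v => 'd (fun p : vec * vec => f p.1 p.2) (x, u) (0, v)).
Proof.
move=> df; have h := is_diff_comp (is_diff_pair (is_diff_cst x u) (is_diff_id u))
  (differentiableP df).
exact: (is_diff_eq h).
Qed.

(** By [is_diff_vinv] and [is_diff_sandwich] all the derivatives of f occur at
    reflected vectors, and [dirac_symbol_vrefl] turns them into Dirac operators
    of f in x and in u.  Only the term <v,w> y of the differential of the
    reflection is of another kind: it gives w y 'D_y = - y u 'D_y. *)
Lemma dirac_inversion (f : vec -> vec -> Cl) y w :
  y != 0 -> let x := vinv y in let u := vrefl y w in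
  differentiable (fun p : vec * vec => f p.1 p.2) (x, u) ->
  dirac_op (f x) u = 0 ->
  dirac_op (fun z => Gkernel z * f (vinv z) (enorm z ^- 2 *: sandwich z w)) y
  = enorm y ^- m.+2 *:
      (cvec y * (dirac_op (f^~ u) x + cvec u * 'D_(2 *: y) (f x) u)).
Proof.
move=> y0 x u df fu0.
set F := fun p : vec * vec => f p.1 p.2 in df *.
have [A dA AE] : exists2 A : {linear vec -> Cl}, is_diff x (f^~ u) A &
    forall v, 'd F (x, u) (v, 0) = A v.
  have [d1 d2] := is_diff_partial1 df.
  by exists ('d (f^~ u) x) => [|v]; [exact: differentiableP|rewrite d2].
have [B dB BE] : exists2 B : {linear vec -> Cl}, is_diff u (f x) B &
    forall v, 'd F (x, u) (0, v) = B v.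
  have [d1 d2] := is_diff_partial2 df.
  by exists ('d (f x) u) => [|v]; [exact: differentiableP|rewrite d2].
have ABE a b : 'd F (x, u) (a, b) = A a + B b.
  rewrite -AE -BE -linearD; congr ('d F _ _).
  by apply/pair_equal_spec; rewrite /= addr0 add0r.
have sE : enorm y ^- 2 *: sandwich y w = u by rewrite sandwich_vrefl.
have dp : is_diff y (fun z => (vinv z, enorm z ^- 2 *: sandwich z w)) _ :=
  is_diff_pair (is_diff_vinv y0) (is_diff_sandwich w y0).
have dF : is_diff (vinv y, enorm y ^- 2 *: sandwich y w)
    F (fun p => A p.1 + B p.2).
  rewrite sE; apply: is_diff_eq (differentiableP df) _.
  by apply/funext => -[a b]; rewrite ABE.
have := is_diff_mul (is_diff_Gkernel y0) (is_diff_comp dp dF).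
move=> /dirac_op_is_diff /= ->; rewrite sE -/x dirac_symbolD.
rewrite (dirac_symbol_mulr (fun v => _ *: _ + _ *: _)).
rewrite dirac_symbol_Gkernel // mul0r add0r.
rewrite (dirac_op_is_diff dA) (derive_is_diff _ dB).
have dsB : dirac_symbol B = 0 by rewrite -(dirac_op_is_diff dB).
transitivity (enorm y ^- m.+2 *:
  (- 1 *: dirac_symbol (fun v => cvec y * A (vrefl y v))
   + (- 2) *: (dirac_symbol (fun v => dot v w *: (cvec y * B y))
        + dot y w *: dirac_symbol (fun v => cvec y * B (vrefl y v))))).
  rewrite -!dirac_symbolZ -!dirac_symbolD -dirac_symbolZ -dirac_symbolD.
  rewrite -dirac_symbolZ.
  apply: eq_bigr => i _; congr (_ * _).
  (* Generalized so that linearity is not applied inside the reflection. *)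
  move: (vrefl y _) (dot _ w) => r t.
  rewrite [A _]linearZ [B _]linearZ linearD !linearZ /= /Gkernel -!scalerAl.
  rewrite !mulrDr -!scalerAr !mulrDr -!scalerAr !scalerDr !scalerA.
  have c : enorm y ^- m / enorm y ^+ 2 = enorm y ^- m.+2.
    by rewrite -invfM -exprD addn2.
  by congr (_ *: _ + (_ *: _ + _ *: _)); rewrite -c /GRing.scale /=; ring.
rewrite !dirac_symbol_vrefl // dsB mulr0 oppr0 scaler0 addr0.
rewrite dirac_symbol_dot scaleN1r opprK scaleNr.
rewrite mulrA cvec_mulr_vrefl // -/u mulNr scalerN opprK mulrDr.
by rewrite linearZ -!scalerAr !mulrA.
Qed.

Lemma is_diff_vrefl y w : is_diff w (vrefl y) (vrefl y).
Proof.
have E : vrefl y = (fun v => v - ((2 * enorm y ^- 2) * dot v y) *: y).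
  by apply/funext => v; rewrite /vrefl dotC mulrAC.
rewrite E; have h := is_diffB (is_diff_id w)
  (is_diff_scale (is_diffZ (2 * enorm y ^- 2) (is_diff_dot y w)) (is_diff_cst y w)).
apply: (is_diff_eq h).
by apply/funext => v; rewrite !fctE scaler0 addr0.
Qed.

(** Both factors of u D_u anticommute with K |-> y K(s_y(.)), after reflecting
    the variable, so that the two signs cancel. *)
Lemma fischer_proj_vrefl k (c : R) (K : vec -> Cl) y w : y != 0 ->
  differentiable K (vrefl y w) ->
  fischer_proj k (fun v => c *: (cvec y * K (vrefl y v))) w =
  c *: (cvec y * fischer_proj k K (vrefl y w)).
Proof.
move=> y0 dK; rewrite /fischer_proj; set a := _^-1.
have d1 := is_diff_comp (is_diff_vrefl y w) (differentiableP dK).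
have d2 := is_diffZ c (is_diff_mul (is_diff_cst (cvec y) w) d1).
rewrite (dirac_op_is_diff d2) (dirac_op_is_diff (differentiableP dK)).
rewrite (_ : dirac_symbol _ =
    c *: dirac_symbol (fun v => cvec y * 'd K (vrefl y w) (vrefl y v))).
  rewrite dirac_symbol_vrefl // -scalerAr mulrN mulrA cvec_mulr_vrefl //.
  rewrite mulNr opprK mulrDr scalerDr -scalerAr !scalerA [a * c]mulrC.
  by rewrite mulrA.
rewrite -dirac_symbolZ; congr dirac_symbol; apply/funext => v.
by rewrite fctE /= mul0r add0r.
Qed.

(** The sum of the e_i e_i is -m, and moving e_i past u leaves the Euler
    operator 'D_u. *)
Lemma dirac_op_cvecl (g : vec -> Cl) u : differentiable g u ->
  dirac_op (fun v => cvec v * g v) u =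
  (- m%:R) *: g u - 2 *: 'D_u g u - cvec u * dirac_op g u.
Proof.
move=> dg.
rewrite (dirac_op_is_diff (is_diff_mul (is_diff_cvec u) (differentiableP dg))).
rewrite (dirac_op_is_diff (differentiableP dg)).
rewrite dirac_symbolD dirac_symbol_mulr dirac_symbol_cvec dirac_symbol_cvecl.
by rewrite -scalerAl mul1r addrA addrAC deriveE.
Qed.

(** For g in M_k, D_u (u g) = -(m+2k) g, and m+2k is the denominator in P_(k+1):
    the projection onto M_(k+1) is zero on u M_k. *)
Lemma fischer_proj_cvecl k (g : vec -> Cl) u : (0 < m)%N -> (1 < m + k.*2)%N ->
  differentiable g u -> dirac_op g u = 0 -> 'D_u g u = k%:R *: g u ->
  fischer_proj k.+1 (fun v => cvec v * g v) u = 0.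
Proof.
move=> m0 mk dg g0 eg; rewrite /fischer_proj dirac_op_cvecl // g0 mulr0 subr0 eg.
rewrite scalerA -scalerBl -scalerAr scalerA.
rewrite [X in X *: _](_ : _ = -1) ?scaleN1r ?addNr //.
have n0 : (m%:R + 2 * k.+1%:R - 2 : R) != 0.
  rewrite [X in X != 0](_ : _ = (m + k.*2)%:R) ?pnatr_eq0 -?lt0n ?addn_gt0 ?m0 //.
  by rewrite natrD -muln2 natrM -natr1; ring.
apply: (mulfI n0); rewrite mulrA mulfV // mul1r -natr1; ring.
Qed.

Lemma fischer_projD k (p q : vec -> Cl) u :
  differentiable p u -> differentiable q u ->
  fischer_proj k (fun v => p v + q v) u =
  fischer_proj k p u + fischer_proj k q u.
Proof.
move=> dp dq; rewrite /fischer_proj.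
rewrite (dirac_op_is_diff (is_diffD (differentiableP dp) (differentiableP dq))).
rewrite !(dirac_op_is_diff (differentiableP _)) // dirac_symbolD mulrDr scalerDr.
by rewrite addrACA.
Qed.

End Inversion.

(** * Interpolation and differentiation with respect to a parameter *)

Section Interpolation.
Variables (R : realType) (m k : nat).
Local Notation Cl := (clifford R m).
Local Notation vec := 'rV[R]_m.
Local Notation idx := {ffun 'I_m -> 'I_k.+1}.

Definition lagr (j : 'I_k.+1) : {poly R} :=
  tnth (k.+1.-lagrange (fun n => n%:R : R)) j.

Lemma lagr_interp (q : {poly R}) t : (size q <= k.+1)%N ->
  q.[t] = \sum_(j < k.+1) q.[j%:R] * (lagr j).[t].
Proof.
move=> sq; rewrite {1}(@lagrange_gen R k.+1 (fun n => n%:R : R) _ _ q sq) //.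
  by rewrite horner_sum; apply: eq_bigr => j _; rewrite hornerM hornerC.
by move=> i j /eqP; rewrite eqr_nat => /eqP.
Qed.

Definition node (a : idx) : vec := \row_i (a i)%:R.
Definition lagr_basis (a : idx) (u : vec) : R := \prod_i (lagr (a i)).[u 0 i].

(** The property of being a polynomial of degree at most k in each variable, in
    the form of a linear relation between values: in this form it passes to
    derivatives with respect to a parameter. *)
Definition interpolable (p : vec -> Cl) : Prop :=
  forall u, p u = \sum_a lagr_basis a u *: p (node a).

Lemma interpolable_prod (q : 'I_m -> {poly R}) (c : Cl) :
  (forall i, (size (q i) <= k.+1)%N) ->
  interpolable (fun u => (\prod_i (q i).[u 0 i]) *: c).
Proof.
move=> sq u; under [RHS]eq_bigr do rewrite scalerA.
rewrite -scaler_suml; congr (_ *: _).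
under eq_bigr do rewrite (lagr_interp _ (sq _)).
rewrite bigA_distr_bigA; apply: eq_bigr => a _.
rewrite -big_split; apply: eq_bigr => i _ /=.
by rewrite mulrC mxE.
Qed.

Lemma interpolable_sum (I : finType) (P : pred I) (p : I -> vec -> Cl) :
  (forall i, interpolable (p i)) ->
  interpolable (fun u => \sum_(i | P i) p i u).
Proof.
move=> ip u; under [RHS]eq_bigr do rewrite scaler_sumr.
by rewrite exchange_big; apply: eq_bigr => i _; apply: ip.
Qed.

(** The homogeneous polynomials are not stable under translation; the degree in
    each variable remains bounded by k. *)
Lemma interpolable_shift (p : vec -> Cl) z :
  homogeneous_poly k p -> interpolable (fun u => p (z + u)).
Proof.
case=> c pE; under [fun u => _]funext do rewrite pE.
apply: interpolable_sum => a.
have -> : (fun u : vec => (\prod_i (z + u) 0 i ^+ a i) *: c a) =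
    (fun u : vec => (\prod_i (('X + (z 0 i)%:P) ^+ a i).[u 0 i]) *: c a).
  apply/funext => u; congr (_ *: _); apply: eq_bigr => i _.
  by rewrite mxE horner_exp hornerD hornerX hornerC addrC.
apply: interpolable_prod => i; apply: leq_trans (size_poly_exp_leq _ _) _.
by rewrite size_XaddC /= mul1n.
Qed.

Lemma differentiable_bigprod (V : normedModType R) (I : Type) (r : seq I)
    (f : I -> V -> R) x :
  (forall i, differentiable (f i) x) ->
  differentiable (fun y => \prod_(i <- r) f i y) x.
Proof.
move=> df; elim: r => [|i r IH].
  under [fun y => _]funext do rewrite big_nil; exact: differentiable_cst.
under [fun y => _]funext do rewrite big_cons.
exact: (differentiableM (df i) IH).
Qed.

Lemma differentiable_lagr a u : differentiable (lagr_basis a) u.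
Proof.
apply: differentiable_bigprod => i.
apply: (@differentiable_comp _ _ _ _ (fun v : vec => v 0 i : R)
  (horner (lagr (a i)))); first exact: differentiable_coord.
exact/derivable1_diffP/derivable_horner.
Qed.

Lemma interpolable_diff (p : vec -> Cl) u : interpolable p ->
  is_diff u p (fun v => \sum_a 'd (lagr_basis a) u v *: p (node a)).
Proof.
move=> ip; rewrite {1}(_ : p = (fun u => \sum_a lagr_basis a u *: p (node a))).
  apply: (@is_diff_bigsum _ _ _ _ (fun a u => lagr_basis a u *: p (node a))
    (fun a v => 'd (lagr_basis a) u v *: p (node a))) => a.
  have h := is_diff_scale (differentiableP (differentiable_lagr a u))
    (is_diff_cst (p (node a)) u).
  by apply: (is_diff_eq h); apply/funext => v; rewrite scaler0 addr0.
exact/funext.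
Qed.

(** The Dirac operator applied to a scalar Lagrange basis function. *)
Definition lagr_dirac (a : idx) (u : vec) : Cl :=
  \sum_i 'd (lagr_basis a) u (delta_mx 0 i) *: cgen R i.

Lemma interpolable_dirac (p : vec -> Cl) u : interpolable p ->
  dirac_op p u = \sum_a lagr_dirac a u * p (node a).
Proof.
move=> ip; rewrite (dirac_op_is_diff (interpolable_diff u ip)) /dirac_symbol.
under eq_bigr do rewrite mulr_sumr.
rewrite exchange_big; apply: eq_bigr => a _; rewrite mulr_suml.
by apply: eq_bigr => i _; rewrite -scalerAr scalerAl.
Qed.

(** Differentiability in the parameter is required pointwise in the variable,
    which is what a continuously differentiable f of two variables provides. *)
Section Family.
Variables (V : normedModType R) (P : V -> vec -> Cl) (t v : V).
Hypothesis dP : forall u, differentiable (P^~ u) t.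
Hypothesis iP : \forall s \near t, interpolable (P s).

Lemma derive_node_comb (c : idx -> Cl) :
  'D_v (fun s => \sum_a c a * P s (node a)) t =
  \sum_a c a * 'D_v (P^~ (node a)) t.
Proof.
have h a := is_diff_mul (is_diff_cst (c a) t) (differentiableP (dP (node a))).
rewrite (derive_is_diff v (is_diff_bigsum h)); apply: eq_bigr => a _.
by rewrite /= mul0r add0r deriveE.
Qed.

(** The interpolation identity has coefficients independent of the parameter, so
    it can be differentiated term by term. *)
Lemma interpolable_derive : interpolable (fun u => 'D_v (P^~ u) t).
Proof.
move=> u; have E : \forall s \near t,
    P s u = \sum_a (lagr_basis a u)%:A * P s (node a).
  apply: filterS iP => s ->; apply: eq_bigr => a _.
  by rewrite -scalerAl mul1r.
rewrite (near_eq_derive v E) derive_node_comb; apply: eq_bigr => a _.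
by rewrite -scalerAl mul1r.
Qed.

(** On interpolable functions the Dirac operator is a combination of the values
    at the nodes, so it commutes with the derivative in the parameter. *)
Lemma monogenic_derive : (\forall s \near t, left_monogenic (P s)) ->
  left_monogenic (fun u => 'D_v (P^~ u) t).
Proof.
move=> mP u; rewrite (interpolable_dirac u interpolable_derive).
rewrite -derive_node_comb -[RHS](derive_cst 0 t v).
apply: near_eq_derive; near=> s.
rewrite -interpolable_dirac; last by near: s.
by apply: (near mP s).
Unshelve. all: by end_near. Qed.

End Family.
End Interpolation.

(** * Directional derivatives of homogeneous polynomials *)

Section Homogeneous.
Variables (R : realType) (m k : nat).
Local Notation Cl := (clifford R m).
Local Notation vec := 'rV[R]_m.
Implicit Types (p : vec -> Cl) (u v y z : vec).

Lemma derive_shiftl p z u v : 'D_v (fun w => p (z + w)) u = 'D_v p (z + u).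
Proof.
rewrite /derive; set q1 := (X in lim (X @ _)); set q2 := (X in _ = lim (X @ _)).
by suff -> : q1 = q2 by []; apply/funext => h; rewrite /q1 /q2 /= addrCA.
Qed.

Lemma derive_shift0 p u v : 'D_v (fun z => p (z + u)) 0 = 'D_v p u.
Proof.
rewrite /derive; set q1 := (X in lim (X @ _)); set q2 := (X in _ = lim (X @ _)).
by suff -> : q1 = q2 by []; apply/funext => h; rewrite /q1 /q2 /= addr0 add0r.
Qed.

Lemma homogeneous_interpolable p : homogeneous_poly k p -> interpolable k p.
Proof.
move=> hp; have := interpolable_shift 0 hp.
by under [fun _ => _]funext do rewrite add0r.
Qed.

Lemma homogeneous_differentiable p u : homogeneous_poly k p -> differentiable p u.
Proof. by move/homogeneous_interpolable/(interpolable_diff u) => []. Qed.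

Lemma homogeneous_scale p t u : homogeneous_poly k p ->
  p (t *: u) = t ^+ k *: p u.
Proof.
case=> c pE; rewrite !pE scaler_sumr; apply: eq_bigr => a /eqP ak.
rewrite scalerA; congr (_ *: _).
rewrite -[in t ^+ _]ak -prodrXr -big_split.
by apply: eq_bigr => i _ /=; rewrite mxE exprMn.
Qed.

End Homogeneous.

(** The derivative 'D_y p is the derivative at z = 0 of the family of the
    translates u |-> p(z + u), to which the results on parameters apply. *)
Section HomogeneousDerivative.
Variables (R : realType) (m k : nat).
Local Notation Cl := (clifford R m).
Local Notation vec := 'rV[R]_m.
Variables (p : vec -> Cl) (y : vec).
Hypothesis hp : homogeneous_poly k.+1 p.

Let shift_diff u : differentiable (fun z => p (z + u)) 0.
Proof.
apply: (@differentiable_comp _ _ _ _ (fun z : vec => z + u) p).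
  by have [] := is_diffD (is_diff_id (0 : vec)) (is_diff_cst u (0 : vec)).
exact: homogeneous_differentiable hp.
Qed.

Let shift_interpolable :
  \forall z \near (0 : vec), interpolable k.+1 (fun u => p (z + u)).
Proof. by near=> z; exact: interpolable_shift. Unshelve. all: by end_near. Qed.

Let derive_shift_family : (fun u => 'D_y (fun z => p (z + u)) 0) = 'D_y p.
Proof. by apply/funext => u; exact: derive_shift0. Qed.

Lemma derive_homogeneous_diff u : differentiable ('D_y p) u.
Proof.
have := interpolable_derive y shift_diff shift_interpolable.
rewrite derive_shift_family.
by move/(interpolable_diff u) => [].
Qed.

Lemma derive_homogeneous_monogenic : left_monogenic p -> left_monogenic ('D_y p).
Proof.
move=> mp.
have := monogenic_derive y shift_diff shift_interpolable.
rewrite derive_shift_family.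
apply; near=> z => u; rewrite -[RHS](mp (z + u)).
by apply: eq_bigr => i _; rewrite derive_shiftl.
Unshelve. all: by end_near. Qed.

(** Differentiating p(t v) = t^(k+1) p(v) in v produces a factor t on the left;
    dividing by it excludes t = 0, which is harmless near t = 1. *)
Lemma derive_homogeneous_scale t u : t != 0 ->
  'D_y p (t *: u) = t ^+ k *: 'D_y p u.
Proof.
move=> t0; have dp v : differentiable p v by exact: homogeneous_differentiable hp.
have d1 := is_diff_comp (is_diff_scaler t u) (differentiableP (dp (t *: u))).
have d2 := is_diffZ (t ^+ k.+1) (differentiableP (dp u)).
have E : p \o *:%R t = t ^+ k.+1 *: p.
  by apply/funext => v /=; exact: homogeneous_scale.
have chain : 'D_y (p \o *:%R t) u = t *: 'd p (t *: u) y.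
  by apply: etrans (derive_is_diff y d1) _; exact: linearZ.
have [D1 D2] := (deriveE y (dp (t *: u)), deriveE y (dp u)).
apply: (scalerI t0); rewrite scalerA -exprS D1 D2.
by apply: etrans (esym chain) _; rewrite E; exact: derive_is_diff d2.
Qed.

(** 'D_u g(u) is the derivative of t |-> g(t u) at t = 1, and near t = 1 this
    function is t^k g(u). *)
Lemma euler_derive_homogeneous u : 'D_u ('D_y p) u = k%:R *: 'D_y p u.
Proof.
have dg := derive_homogeneous_diff u.
have dl : is_diff (1 : R) (fun t : R => t *: u) (fun t : R => t *: u).
  have h := is_diff_scale (is_diff_id (1 : R)) (is_diff_cst u (1 : R)).
  by apply: (is_diff_eq h); apply/funext => t /=; rewrite scaler0 addr0.
have dg' : is_diff (1 *: u) ('D_y p) ('d ('D_y p) u).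
  by rewrite scale1r; exact: differentiableP.
have radial : 'D_1 ('D_y p \o (fun t : R => t *: u)) (1 : R) = 'D_u ('D_y p) u.
  rewrite (derive_is_diff (1 : R) (is_diff_comp dl dg')).
  by rewrite [RHS]deriveE //= scale1r.
rewrite -radial.
have d1 : is_derive (1 : R) 1 ((@id R) ^+ k) ((k%:R * 1 ^+ k.-1) *: 1).
  exact: is_deriveX.
have dk := is_diff_comp_real (is_diff_id (1 : R)) d1.
have d2 := is_diff_scale dk (is_diff_cst ('D_y p u) (1 : R)).
have power : 'D_1 (fun t => ((@id R) ^+ k) t *: cst ('D_y p u) t) (1 : R)
    = k%:R *: 'D_y p u.
  apply: etrans (derive_is_diff (1 : R) d2) _.
  by rewrite scaler0 addr0 /GRing.scale /= expr1n !mulr1.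
rewrite -power; apply: near_eq_derive.
near=> t; rewrite /= exprfctE; apply: derive_homogeneous_scale.
near: t; exact: (@cvgr_neq0 _ R^o _ _ _ id (1 : R) cvg_id (oner_neq0 R)).
Unshelve. all: by end_near. Qed.

End HomogeneousDerivative.

(** No second derivative of f is available, but near x the functions f(z, .) are
    polynomials, which [interpolable_derive] differentiates in z. *)
Lemma dirac_differentiable (R : realType) (m k : nat) (U : set 'rV[R]_m)
    (f : 'rV[R]_m -> 'rV[R]_m -> clifford R m) x :
  open U -> U x -> (forall z, U z -> homogeneous_poly k (f z)) ->
  (forall u, differentiable (f^~ u) x) ->
  forall u, differentiable (fun u => dirac_op (f^~ u) x) u.
Proof.
move=> oU Ux hf df u.
have nf : \forall z \near x, interpolable k (f z).
  have : \forall z \near x, U z by exact: open_nbhs_nbhs.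
  by apply: filterS => z /hf; exact: homogeneous_interpolable.
have d i := is_diff_mul (is_diff_cst (cgen R i) u)
  (interpolable_diff u (interpolable_derive (delta_mx 0 i) df nf)).
by have [] := is_diff_bigsum d.
Qed.

Theorem theorem3 (R : realType) (m k : nat) (U : set 'rV[R]_m)
    (f : 'rV[R]_m -> 'rV[R]_m -> clifford R m)
    (m_ge3 : (3 <= m)%N) (k_ge1 : (1 <= k)%N)
    (U_open : open U) (U_connected : connected U) (U_neq0 : U !=set0)
    (f_C1 : C1_on (U `*` [set: 'rV[R]_m]) (fun p => f p.1 p.2))
    (f_monogenic : forall x, U x -> monogenic_space k (f x))
    (f_null : forall x u, U x -> rarita_schwinger k f x u = 0) :
  forall y w : 'rV[R]_m, y != 0 -> U (vinv y) ->
    rarita_schwinger k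
      (fun y' w' => Gkernel y' *
         f (vinv y') (enorm y' ^- 2 *: sandwich y' w')) y w
    = 0.
Proof.
move=> y w y0 Ux; case: k k_ge1 f_monogenic f_null => // k _ f_mono f_null.
have [hom mono] := f_mono _ Ux.
have df u : differentiable (fun p => f p.1 p.2) (vinv y, u).
  by have [] := f_C1 (vinv y, u).
pose F u := dirac_op (f^~ u) (vinv y).
pose q u := cvec u * 'D_(2 *: y) (f (vinv y)) u.
pose K u := F u + q u.
rewrite /rarita_schwinger.
have -> : (fun w' => dirac_op (fun z => Gkernel z *
      f (vinv z) (enorm z ^- 2 *: sandwich z w')) y) =
    (fun w' => enorm y ^- m.+2 *: (cvec y * K (vrefl y w'))).
  by apply/funext => w'; exact: dirac_inversion.
have dF : differentiable F (vrefl y w).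
  apply: (@dirac_differentiable _ _ k.+1 U) => // [z /f_mono[] //|u].
  by have [] := is_diff_partial1 (df u).
have dg := derive_homogeneous_diff (2 *: y) hom (vrefl y w).
have dq : differentiable q (vrefl y w).
  by have [] := is_diff_mul (is_diff_cvec (vrefl y w)) (differentiableP dg).
rewrite (fischer_proj_vrefl _ _ (K := K)) //; last exact: differentiableD.
rewrite fischer_projD // [fischer_proj _ F _]f_null // add0r.
rewrite fischer_proj_cvecl ?mulr0 ?scaler0 //.
- exact: leq_trans m_ge3.
- by apply: leq_trans (leq_addr _ _); exact: leq_trans m_ge3.
- exact: (derive_homogeneous_monogenic (2 *: y) hom mono).
- exact: euler_derive_homogeneous.
Qed.
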